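(* Let $\mathcal{R}$ be a commutative ring with a quasi-valuation $\mathsf{e}$, and let $\mathcal{R}^\dag=\{f\in\mathcal{R}\mid \mathsf{e}(fg)=\mathsf{e}(f)+\mathsf{e}(g)\ \forall g\in\mathcal{R}\}$. Let $\mathcal{A}=(\mathcal{A}_{ij})\in\mathcal{R}^{n\times n}$. Assume that $\mathcal{A}$ has $n$ algebraic eigenvalues (counted with multiplicities) and that they all belong to $\mathcal{R}^\dag$. Denote by $\Lambda=(\Lambda_1\le\cdots\le\Lambda_n)$ the sequence of their images by $\mathsf{e}$ (counted with multiplicities). Let $\Gamma=(\gamma_1\le\cdots\le\gamma_n)$ be the sequence of min-plus algebraic eigenvalues of $\mathsf{e}(\mathcal{A}):=(\mathsf{e}(\mathcal{A}_{ij}))\in\mathbb{R}_{\min}^{n\times n}$. Then $\Lambda$ is weakly (super) majorized by $\Gamma$.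
   Context: A quasi-valuation on a ring $\mathcal{R}$ is a map $\mathsf{e}:\mathcal{R}\to\mathbb{R}\cup\{+\infty\}$ such that $\mathsf{e}(f+g)\ge\min(\mathsf{e}(f),\mathsf{e}(g))$ and $\mathsf{e}(fg)\ge\mathsf{e}(f)+\mathsf{e}(g)$ for all $f,g\in\mathcal{R}$, and $\mathsf{e}(-1)=0$. That $\mathcal{A}$ has $n$ algebraic eigenvalues counted with multiplicities means that its characteristic polynomial $\det(\mathsf{Y}I-\mathcal{A})\in\mathcal{R}[\mathsf{Y}]$ factors as $\prod_{i=1}^n(\mathsf{Y}-\mathcal{L}_i)$ with $\mathcal{L}_i\in\mathcal{R}$; these $\mathcal{L}_i$ are the eigenvalues. $\mathbb{R}_{\min}=\mathbb{R}\cup\{+\infty\}$ is the min-plus semifield, with addition $a\oplus b=\min(a,b)$, multiplication $ab=a+b$ (usual sum), zero element $+\infty$ and unit element $0$. A formal polynomial $P=\bigoplus_{k=0}^n P_k\mathsf{Y}^k$ of degree $n$ over $\mathbb{R}_{\min}$ (so $P_n\ne+\infty$) has associated polynomial function $\widehat P(y)=\min_k(P_k+ky)$, $y\in\mathbb{R}_{\min}$ (the term $k=0$ being $P_0$). It factors uniquely as $\widehat P(y)=P_n+\sum_{i=1}^n\min(y,c_i)$ with $c_1\le\cdots\le c_n$ in $\mathbb{R}_{\min}$; the $c_i$ are the (min-plus) roots of $P$. For $A\in\mathbb{R}_{\min}^{n\times n}$, the min-plus characteristic polynomial is $P_A=\bigoplus_{k=0}^n (P_A)_k\mathsf{Y}^k$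 with $(P_A)_n=0$ and, for $0\le k\le n-1$, $(P_A)_k=\min_{J\subset[n],\,\#J=n-k}\ \min_{\sigma\in\mathfrak{S}_J}\sum_{j\in J}A_{j\sigma(j)}$, where $[n]=\{1,\dots,n\}$ and $\mathfrak{S}_J$ is the set of permutations of $J$. The min-plus algebraic eigenvalues of $A$ are the $n$ roots of $P_A$. For $u,v\in\mathbb{R}_{\min}^n$ with increasingly ordered entries $u_{(1)}\le\cdots\le u_{(n)}$ and $v_{(1)}\le\cdots\le v_{(n)}$, $u$ is weakly (super) majorized by $v$, written $u\prec^{\rm w}v$, if $u_{(1)}+\cdots+u_{(k)}\ge v_{(1)}+\cdots+v_{(k)}$ for all $k=1,\dots,n$ (usual sums in $\mathbb{R}\cup\{+\infty\}$). *)

(* Defs.v *)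
From mathcomp Require Import all_boot all_order all_fingroup all_algebra.
From mathcomp Require Import reals constructive_ereal.

Set Implicit Arguments.
Unset Strict Implicit.
Unset Printing Implicit Defensive.

Import Order.TTheory GRing.Theory Num.Theory.

Local Open Scope ring_scope.
Local Open Scope ereal_scope.

(* The min-plus semifield R_min is represented by the extended reals [\bar R]
   deprived of [-oo]: its addition is [mine], its multiplication is [+], its
   zero is [+oo] and its unit is [0]. The exclusion of [-oo] is stated where
   the elements of R_min are introduced. *)

Definition quasi_valuation (R : realType) (S : comNzRingType)
    (e : S -> \bar R) : Prop :=
  [/\ forall f, e f != -oo,
      forall f g, mine (e f) (e g) <= e (f + g)%R,
      forall f g, e f + e g <= e (f * g)%R &
      e (- 1)%R = 0].

(* The elements f for which e(fg) >= e(f) + e(g) is an equality for all g. *)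
Definition in_dagger (R : realType) (S : comNzRingType)
    (e : S -> \bar R) (f : S) : Prop :=
  forall g, e (f * g)%R = e f + e g.

(* A formal min-plus polynomial of degree n is given by its coefficients
   [P : 'I_n.+1 -> \bar R]. Its leading coefficient [P ord_max] must differ
   from [+oo]. The term [y *+ k] is the usual multiple [k y], and it is [0] for
   [k = 0], even if [y = +oo]. *)
Definition minplus_eval (R : realType) (n : nat) (P : 'I_n.+1 -> \bar R)
    (y : \bar R) : \bar R :=
  \big[mine/+oo]_(k < n.+1) (P k + y *+ k).

(* The roots are defined by the unique factorization of the polynomial function
   over R_min: the increasing sequence [c] is determined by [P], provided that
   [P ord_max] differs from [+oo]. *)
Definition minplus_roots (R : realType) (n : nat) (P : 'I_n.+1 -> \bar R)
    (c : n.-tuple (\bar R)) : Prop :=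
  [/\ sorted <=%O c,
      forall i, tnth c i != -oo &
      forall y, y != -oo ->
        minplus_eval P y = P ord_max + \sum_(i < n) mine y (tnth c i)].

(* The permutations of J are represented by the permutations of 'I_n which fix
   every element outside of J. *)
Definition minplus_char_poly (R : realType) (n : nat) (A : 'M[\bar R]_n)
    (k : 'I_n.+1) : \bar R :=
  if k == ord_max then 0 else
  \big[mine/+oo]_(J : {set 'I_n} | #|J| == (n - k)%N)
    \big[mine/+oo]_(s : {perm 'I_n} | perm_on J s)
      \sum_(j in J) A j (s j).

Definition minplus_eigenvalues (R : realType) (n : nat) (A : 'M[\bar R]_n)
    (c : n.-tuple (\bar R)) : Prop :=
  minplus_roots (minplus_char_poly A) c.

(* [u] is majorized by [v]: the partial sums of the increasing rearrangement
   of [u] are the larger ones. *)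
Definition weakly_majorized (R : realType) (n : nat)
    (u v : n.-tuple (\bar R)) : Prop :=
  forall k : nat, (1 <= k <= n)%N ->
    \sum_(x <- take k (sort <=%O v)) x <= \sum_(x <- take k (sort <=%O u)) x.

(* Main.v *)
(** By expanding the determinant, every coefficient of the min-plus
    characteristic polynomial of [e(A)] is a lower bound for the image by [e] of
    the corresponding coefficient of [char_poly A].  The latter is, up to sign,
    an elementary symmetric function of the eigenvalues [L_i]; if
    [M = {i | e(L_i) < y}], then in that of degree [#|M|] the product over [M]
    strictly dominates all the others, so that no cancellation occurs and its
    image by [e] is the sum of the [e(L_i)] for [i] in [M].  Hence
    [\sum_i min(y, Gamma_i) <= \sum_i min(y, Lambda_i)] for all real [y].  Taking
    [y = Gamma_k], or [y] large if [Gamma_k] is infinite, gives the inequality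
    between the k-th partial sums. *)
Require Import Defs.
From mathcomp Require Import all_boot all_order all_fingroup all_algebra.
From mathcomp Require Import reals constructive_ereal.

Import Order.TTheory GRing.Theory Num.Theory.

Local Open Scope ring_scope.

(** * Coefficients of products of linear factors and of characteristic polynomials *)

Lemma coef_prod_linear (S : comNzRingType) (n : nat) (c d : 'I_n -> S)
    (k : 'I_n.+1) :
  (\prod_(i < n) ((d i)%:P * 'X + (c i)%:P))`_k =
  \sum_(J : {set 'I_n} | #|J| == (n - k)%N)
    (\prod_(i in J) c i) * \prod_(i in ~: J) d i.
Proof.
under eq_bigr do rewrite addrC.
(* [J] is the set of factors contributing their constant term; the others contribute ['X], so degree
   [k] forces [#|J| = n - k]. *)
rewrite bigA_distr coef_sum [RHS]big_mkcond /=; apply: eq_bigr => J _.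
rewrite (bigID (mem J)) /=.
rewrite (eq_bigr (fun i => (c i)%:P)); last by move=> i /= ->.
rewrite [X in _ * X](eq_bigr (fun i => (d i)%:P * 'X)); last first.
  by move=> i /= /negbTE ->.
rewrite big_split /= prodr_const -!rmorph_prod /= mulrA -polyCM coefCM coefXn.
have -> : #|(fun i : 'I_n => i \notin J)| = (n - #|J|)%N.
  transitivity #|~: J|; last by rewrite cardsCs setCK card_ord.
  by apply: eq_card => i; rewrite in_setC.
rewrite -(eq_bigl _ _ (fun i => in_setC i J)).
have Jn : (#|J| <= n)%N by rewrite -[n in leqRHS]card_ord max_card.
have -> : (k == n - #|J| :> nat)%N = (#|J| == n - k)%N.
  by apply/eqP/eqP => ->; rewrite subKn // -ltnS.
by case: ifP => _; rewrite ?mulr1 ?mulr0.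
Qed.

Lemma coef_prod_XsubC (S : comNzRingType) (n : nat) (L : 'I_n -> S)
    (k : 'I_n.+1) :
  (\prod_(i < n) ('X - (L i)%:P))`_k =
  (-1) ^+ (n - k) * \sum_(J : {set 'I_n} | #|J| == (n - k)%N) \prod_(i in J) L i.
Proof.
rewrite (eq_bigr (fun i => 1%:P * 'X + (- L i)%:P)); last first.
  by move=> i _; rewrite mul1r polyCN.
rewrite coef_prod_linear mulr_sumr; apply: eq_bigr => J /eqP <-.
by rewrite big1_eq mulr1 prodrN.
Qed.

(** The entry at [(i, s i)] has leading coefficient [1] if [s] fixes [i] and [0] otherwise. So the
    product of the leading coefficients outside [J] is the indicator of [perm_on J s]. *)
Lemma coef_char_poly (S : comNzRingType) (n : nat) (A : 'M[S]_n)
    (k : 'I_n.+1) :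
  (char_poly A)`_k =
  \sum_(s : {perm 'I_n}) (-1) ^+ s *
    \sum_(J : {set 'I_n} | #|J| == (n - k)%N)
      if perm_on J s then \prod_(i in J) - A i (s i) else 0.
Proof.
rewrite /char_poly /determinant coef_sum; apply: eq_bigr => s _.
rewrite (eq_bigr (fun i => ((i == s i)%:R)%:P * 'X + (- A i (s i))%:P)); last first.
  by move=> i _; rewrite !mxE polyCN polyCMn -mulr_natl -polyCMn.
have -> : (-1) ^+ s = ((-1) ^+ s)%:P :> {poly S}.
  by rewrite rmorphXn /= polyCN.
rewrite coefCM coef_prod_linear; congr (_ * _).
apply: eq_bigr => J _; case: ifP => [sJ | /negbT sJ].
  rewrite [X in _ * X]big1 ?mulr1 // => i; rewrite inE => iJ.
  by rewrite (out_perm sJ iJ) eqxx.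
have [i iJ iNs] : exists2 i, i \in ~: J & i != s i.
  have /subsetPn[i] := sJ; rewrite inE eq_sym => iNs iJ.
  by exists i; rewrite // inE.
by rewrite (bigD1 i iJ) /= (negbTE iNs) mul0r mulr0.
Qed.

Local Open Scope ereal_scope.

Lemma minplus_char_poly_le (R : realType) (n : nat) (A : 'M[\bar R]_n) (k : 'I_n.+1)
    (J : {set 'I_n}) (s : {perm 'I_n}) :
  #|J| = (n - k)%N -> perm_on J s ->
  minplus_char_poly A k <= \sum_(j in J) A j (s j).
Proof.
move=> cJ sJ; rewrite /minplus_char_poly; case: eqP => [kn | _].
  move: cJ; rewrite kn subnn => /eqP; rewrite cards_eq0 => /eqP ->.
  by rewrite big_set0.
apply: (bigmin_inf J); first exact/eqP.
exact: (bigmin_inf s).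
Qed.

(** * Quasi-valuations of sums and products *)

Section QuasiValuation.
Variables (R : realType) (S : comNzRingType) (e : S -> \bar R).
Hypothesis e_qv : quasi_valuation e.
Implicit Types f g : S.

Lemma qv_neq_ninfty f : e f != -oo. Proof. by case: e_qv. Qed.

Lemma qvD f g : mine (e f) (e g) <= e (f + g)%R. Proof. by case: e_qv. Qed.

Lemma qvM f g : e f + e g <= e (f * g)%R. Proof. by case: e_qv. Qed.

Lemma qvN f : e (- f)%R = e f.
Proof.
have leN g : e g <= e (- g)%R.
  by case: e_qv => _ _ _ eN1; rewrite -mulN1r -[leLHS]add0e -eN1 qvM.
by apply/le_anti; rewrite leN andbT -[in leRHS](opprK f) leN.
Qed.

Lemma qv_sign k f : e ((-1) ^+ k * f)%R = e f.
Proof. by rewrite -signr_odd; case: odd; rewrite ?mulN1r ?qvN ?mul1r. Qed.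

Lemma qv1 : e 1%R = 0.
Proof. by rewrite -qvN; case: e_qv. Qed.

Lemma qv_le0 f : e f <= e 0%R.
Proof. by rewrite -(subrr f) -[leLHS]minxx -{2}(qvN f) qvD. Qed.

Lemma qv_prod (I : Type) (r : seq I) (P : pred I) (F : I -> S) :
  \sum_(i <- r | P i) e (F i) <= e (\prod_(i <- r | P i) F i)%R.
Proof.
elim/big_rec2: _ => [|i f x _ le_xf]; first by rewrite qv1.
by apply: le_trans (qvM _ _); rewrite leeD2l.
Qed.

Lemma qv_prod_dagger (I : Type) (r : seq I) (P : pred I) (F : I -> S) :
  (forall i, P i -> in_dagger e (F i)) ->
  e (\prod_(i <- r | P i) F i)%R = \sum_(i <- r | P i) e (F i).
Proof.
move=> Fd; elim/big_rec2: _ => [|i f x Pi <-]; first exact: qv1.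
exact: Fd.
Qed.

(** The bound at [0] handles empty sums: the axioms do not force [e 0] to be [+oo]. *)
Lemma qv_sum_ge (I : Type) (r : seq I) (P : pred I) (F : I -> S) x :
  x <= e 0%R -> (forall i, P i -> x <= e (F i)) ->
  x <= e (\sum_(i <- r | P i) F i)%R.
Proof.
move=> x0 xF; elim/big_ind: _ => // f g xf xg.
by apply: le_trans (qvD _ _); rewrite le_min xf.
Qed.

(** Writing [f] as [(f + g) - g] bounds [e f] below by the minimum of [e (f + g)] and [e g], and the
    latter is too large. *)
Lemma qvD_lt f g : e f < e g -> e (f + g)%R = e f.
Proof.
move=> fg; apply/le_anti/andP; split; last first.
  by apply: le_trans (qvD _ _); rewrite le_min lexx ltW.
have := qvD (f + g)%R (- g)%R; rewrite addrK qvN ge_min => /orP[//|].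
by rewrite leNgt fg.
Qed.

Lemma qv_sum_dominant (I : finType) (P : pred I) (F : I -> S) j :
  P j -> (forall i, P i -> i != j -> e (F j) < e (F i)) ->
  e (\sum_(i | P i) F i)%R = e (F j).
Proof.
move=> Pj ltF; rewrite (bigD1 j) //=.
elim/big_rec: _ => [|i f /andP[Pi ij] IH]; first by rewrite addr0.
by rewrite addrCA addrC qvD_lt IH // ltF.
Qed.

Lemma minplus_char_poly_le_qv (n : nat) (A : 'M[S]_n) (k : 'I_n.+1) :
  minplus_char_poly (map_mx e A) k <= e (char_poly A)`_k.
Proof.
have le_prod (J : {set 'I_n}) (s : {perm 'I_n}) :
    #|J| = (n - k)%N -> perm_on J s ->
    minplus_char_poly (map_mx e A) k <= e (\prod_(i in J) - A i (s i))%R.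
  move=> cJ sJ; apply: le_trans (qv_prod _ _ _ _).
  apply: le_trans (minplus_char_poly_le _ _ _ _ _ _ cJ sJ) _.
  by apply: lee_sum => i _; rewrite mxE qvN.
(* Since [e 0] is the largest value of [e], a single admissible pair suffices: any [J] of the right
   size with the identity. *)
have le0 : minplus_char_poly (map_mx e A) k <= e 0%R.
  have /card_geqP[r [ur sr _]] : (n - k <= #|'I_n|)%N.
    by rewrite card_ord leq_subr.
  apply: le_trans (qv_le0 _); apply: (le_prod [set i in r] 1%g).
    by rewrite cardsE (card_uniqP ur).
  exact: perm_on1.
rewrite coef_char_poly; apply: qv_sum_ge => // s _; rewrite qv_sign.
by apply: qv_sum_ge => // J /eqP cJ; case: ifP => // /(le_prod _ _ cJ).
Qed.

End QuasiValuation.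

(** * Evaluation of the min-plus characteristic polynomial at a real point *)

Lemma sume_if (R : realType) (n : nat) (J : {set 'I_n}) (a : 'I_n -> \bar R) y :
  \sum_(i < n) (if i \in J then a i else y) =
  \sum_(i in J) a i + y *+ (n - #|J|).
Proof.
have -> : y *+ (n - #|J|) = \sum_(i in ~: J) y.
  by rewrite sumr_const (cardsCs (~: J)) setCK card_ord.
rewrite (bigID (mem J)) /=; congr (_ + _).
  by apply: eq_bigr => i ->.
by apply: eq_big => [i | i /negbTE ->] //; rewrite inE.
Qed.

Lemma lte_sum_fin (R : realType) (I : finType) (f g : I -> \bar R) j :
  (forall i, f i \is a fin_num) -> (forall i, f i <= g i) -> f j < g j ->
  \sum_i f i < \sum_i g i.
Proof.
move=> ffin le_fg lt_fg; rewrite (bigD1 j) //= [ltRHS](bigD1 j) //=.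
by apply: lte_leD => //; [exact/sum_fin_numP | exact: lee_sum].
Qed.

Lemma mine_fin_num (R : realType) (y : R) (x : \bar R) :
  x != -oo -> mine y%:E x \is a fin_num.
Proof. by case: x => [x| |] // _; rewrite ?(min_l (leey _)) // -EFin_min. Qed.

Lemma minplus_eval_char_poly_le (R : realType) (S : comNzRingType)
    (e : S -> \bar R) (e_qv : quasi_valuation e) (n : nat) (A : 'M[S]_n)
    (L : 'I_n -> S) (y : R) :
  char_poly A = (\prod_(i < n) ('X - (L i)%:P))%R ->
  (forall i, in_dagger e (L i)) ->
  minplus_eval (minplus_char_poly (map_mx e A)) y%:E <=
  \sum_(i < n) mine y%:E (e (L i)).
Proof.
move=> A_L Ld; pose M := [set i | e (L i) < y%:E].
have cM : (#|M| <= n)%N by rewrite -[n in leqRHS]card_ord max_card.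
have minE i : mine y%:E (e (L i)) = if i \in M then e (L i) else y%:E.
  by rewrite inE minC /Order.min.
have [k nk] : exists k : 'I_n.+1, (n - k)%N = #|M|.
  by exists (inord (n - #|M|)); rewrite inordK ?subKn // ltnS leq_subr.
have kE : (n - #|M|)%N = k by rewrite -nk subKn // -ltnS.
have minS : \sum_(i < n) mine y%:E (e (L i)) = \sum_(i in M) e (L i) + y%:E *+ k.
  by under eq_bigr do rewrite minE; rewrite sume_if kE.
have coefE : e (char_poly A)`_k = \sum_(i in M) e (L i).
  rewrite A_L coef_prod_XsubC (qv_sign _ _ _ e_qv) nk.
  rewrite (qv_sum_dominant _ _ _ e_qv _ _ _ M) //.
    by rewrite (qv_prod_dagger _ _ _ e_qv).
  move=> J /eqP cJ neqJM; rewrite !(qv_prod_dagger _ _ _ e_qv) //.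
  (* Adding [k] copies of [y] turns the sum over [M] into the sum of the minima, and the sum over
     [J] into one with [y] outside [J]. These compare term by term, strictly at an index of [M]
     outside [J]. *)
  have yk : y%:E *+ k \is a fin_num by rewrite -EFin_natmul.
  rewrite -(lteD2rE _ _ yk) -minS -[in ltRHS]kE -cJ -sume_if.
  have [j jM jJ] : exists2 j, j \in M & j \notin J.
    apply/subsetPn; apply: contra neqJM => MJ.
    by rewrite eq_sym eqEcard MJ cJ leqnn.
  apply: (lte_sum_fin _ _ _ _ j) => [i|i|].
  - exact/mine_fin_num/(qv_neq_ninfty _ _ _ e_qv).
  - by case: ifP => _; rewrite ge_min lexx ?orbT.
  - by rewrite minE jM (negbTE jJ); move: jM; rewrite inE.
rewrite minS -coefE /minplus_eval; apply: le_trans (bigmin_le _ k _) _.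
by rewrite leeD2r // minplus_char_poly_le_qv.
Qed.

(** * From sums of minima to partial sums *)

Lemma sume_const_seq (R : realType) (I : Type) (s : seq I) (y : \bar R) :
  \sum_(x <- s) y = y *+ size s.
Proof. by rewrite big_const_seq count_predT iter_addr_0. Qed.

Lemma sume_mine_le (R : realType) (s : seq (\bar R)) (k : nat) (y : \bar R) :
  \sum_(x <- s) mine y x <= \sum_(x <- take k s) x + y *+ (size s - k).
Proof.
rewrite -[s in leLHS](cat_take_drop k) big_cat /= leeD //.
  by apply: lee_sum => x _; rewrite ge_min lexx orbT.
rewrite -size_drop -sume_const_seq.
by apply: lee_sum => x _; rewrite ge_min lexx.
Qed.

Lemma sume_mine_sorted (R : realType) (s : seq (\bar R)) (k : nat) (y : \bar R) :
  {in drop k s, forall x, y <= x} ->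
  \sum_(x <- s) mine y x = \sum_(x <- take k s) mine y x + y *+ (size s - k).
Proof.
move=> ys; rewrite -[s in LHS](cat_take_drop k) big_cat /=; congr (_ + _).
rewrite -size_drop -sume_const_seq; apply: eq_big_seq => x /ys yx.
exact: min_l.
Qed.

Lemma weakly_majorized_mine (R : realType) (n : nat) (u v : n.-tuple (\bar R)) :
  sorted <=%O u -> sorted <=%O v ->
  {in u, forall x, x != -oo} -> {in v, forall x, x != -oo} ->
  (forall y : R, \sum_(x <- v) mine y%:E x <= \sum_(x <- u) mine y%:E x) ->
  weakly_majorized u v.
Proof.
move=> su sv uN vN vu k /andP[k0 kn]; rewrite !sorted_sort //; try exact: le_trans.
(* Positions start at [0], so [z] is the [k]-th smallest entry of [v]. *)
pose z := nth 0 v k.-1.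
have k1n : (k.-1 < n)%N by rewrite prednK.
have le_nth i j : (i <= j)%N -> (j < n)%N -> nth 0 v i <= nth 0 v j.
  move=> ij jn; apply: (sorted_leq_nth le_trans le_refl) => //;
    by rewrite inE size_tuple ?(leq_ltn_trans ij).
have z_take x : x \in take k v -> x <= z.
  move=> /(nthP 0)[i]; rewrite size_takel ?size_tuple // => ik <-.
  by rewrite nth_take // le_nth // -ltnS prednK.
have z_drop j x : (k.-1 <= j)%N -> x \in drop j v -> z <= x.
  move=> kj /(nthP 0)[i]; rewrite size_drop size_tuple => ij <-.
  rewrite nth_drop le_nth // -?ltn_subRL //.
  by rewrite (leq_trans kj) // leq_addr.
have vz : z \in (v : seq _) by rewrite mem_nth // size_tuple.
case zE : z (vN z vz) => [y| |] // _.
  (* For [y = z] finite, both sides carry the same finite tail of [n - k] copies of [y], which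
     cancels. *)
  have := le_trans (vu y) (sume_mine_le _ _ k _).
  rewrite (sume_mine_sorted _ _ k) => [|x /(z_drop _ _ (leq_pred _))]; last first.
    by rewrite zE.
  rewrite !size_tuple leeD2rE -?EFin_natmul //.
  rewrite (eq_big_seq id) // => x /z_take; rewrite zE => xy.
  exact: min_r.
(* Here [z = +oo]. If the inequality failed, the partial sum of [u] would be a real [r]. *)
rewrite leNgt; apply/negP => lt_uv.
have [r rE] : exists r : R, \sum_(x <- take k u) x = r%:E.
  exists (fine (\sum_(x <- take k u) x)); rewrite fineK // fin_numE.
  rewrite (lt_eqF (lt_le_trans lt_uv (leey _))) andbT big_seq.
  elim/big_ind: _ => // [x x' xN x'N | x /mem_take /uN //].
  by rewrite adde_eq_ninfty negb_or xN.
pose c := \sum_(x <- take k.-1 v) mine 0%:E x.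
have cE : c \is a fin_num.
  apply/sum_fin_numP => x /mem_take xv _; exact/mine_fin_num/vN.
(* For [y >= 0], the first [k - 1] entries of [v] give at least [c] and the others, all infinite,
   give [n - k + 1] copies of [y]: one more than on the side of [u]. *)
have cr y : (0 <= y)%R -> (fine c + y <= r)%R.
  move=> y0; rewrite -lee_fin EFinD fineK //.
  have yk : y%:E *+ (n - k) \is a fin_num by rewrite -EFin_natmul.
  rewrite -(leeD2rE _ _ yk) -addeA -mulrS -rE.
  have := le_trans (vu y) (sume_mine_le _ _ k _); rewrite size_tuple.
  apply: le_trans.
  rewrite (sume_mine_sorted _ _ k.-1) => [|x /(z_drop _ _ (leqnn _))]; last first.
    by rewrite zE leye_eq => /eqP ->; rewrite leey.
  rewrite size_tuple.
  have -> : (n - k.-1)%N = (n - k).+1 by rewrite -subSn // -[in RHS](prednK k0).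
  rewrite leeD2r //; apply: lee_sum => x _.
  by rewrite le_min !ge_min lee_fin y0 lexx orbT.
(* A nonnegative [y] exceeding [r - c] contradicts this bound. *)
have := cr `|r - fine c + 1|%R (normr_ge0 _).
rewrite leNgt -ltrBlDl => /negP; apply.
by rewrite (lt_le_trans _ (ler_norm _)) // ltrDl ltr01.
Qed.

Local Close Scope ereal_scope.

Theorem theorem5p2 (R : realType) (S : comNzRingType) (e : S -> \bar R)
    (e_qv : quasi_valuation e) (n : nat) (A : 'M[S]_n)
    (L : n.-tuple S)
    (A_eigenvalues : char_poly A = \prod_(i < n) ('X - (tnth L i)%:P))
    (L_dagger : forall i, in_dagger e (tnth L i))
    (Lambda : n.-tuple (\bar R))
    (Lambda_def : Lambda = sort <=%O (map e L) :> seq (\bar R))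
    (Gamma : n.-tuple (\bar R))
    (Gamma_def : minplus_eigenvalues (map_mx e A) Gamma) :
  weakly_majorized Lambda Gamma.
Proof.
case: Gamma_def => sG GN evalG.
have LN : {in Lambda, forall x, x != -oo%E}.
  move=> x; rewrite -[x \in Lambda]/(x \in (Lambda : seq _)) Lambda_def mem_sort.
  by case/mapP => f _ ->; apply: qv_neq_ninfty e_qv f.
apply: weakly_majorized_mine => // [||y].
- by rewrite Lambda_def sort_sorted //; exact: le_total.
- by move=> x /tnthP[i ->].
have -> : (\sum_(x <- Lambda) mine y%:E x = \sum_(i < n) mine y%:E (e (tnth L i)))%E.
  rewrite -(big_tuple _ _ L xpredT (fun f => mine y%:E (e f))) Lambda_def.
  by rewrite (perm_big _ (permEl (perm_sort _ _))) big_map.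
(* The sum over [Gamma] is the value of the min-plus characteristic polynomial at [y], by its
   factorization with leading coefficient [0]. *)
apply: le_trans (minplus_eval_char_poly_le _ _ _ e_qv _ A _ y A_eigenvalues L_dagger).
by rewrite evalG // /minplus_char_poly eqxx add0e big_tuple.
Qed.
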